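(* Let $n\ge2$. The morphism $X(D_{n+1})\to X(D_n)$ induced by the inclusion of root systems $D_n\subset D_{n+1}$ is not flat.
   Context: For $n\ge2$ the root system $D_n$ consists of $\pm u_i\pm u_j$ ($1\le i<j\le n$) in the Euclidean space with basis $u_1,\ldots,u_n$. $X(D_n)$ is the smooth projective toric variety of the fan $\Sigma(D_n)$, in the lattice $N(D_n)$ dual to the root lattice $M(D_n)$, consisting of the Weyl chambers of $D_n$ and their faces. $D_n\subset D_{n+1}$ is the root subsystem of roots in the span of $u_1,\ldots,u_n$; the dual of the inclusion $M(D_n)\subset M(D_{n+1})$ is a map of lattices $N(D_{n+1})\to N(D_n)$ compatible with the fans, which induces the proper surjective toric morphism $X(D_{n+1})\to X(D_n)$. *)

(* Defs.v *)
From HB Require Import structures.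
From mathcomp Require Import all_boot all_order all_algebra.
From mathcomp Require Import finmap generic_quotient ring_quotient.
From mathcomp Require Import boolp classical_sets reals.
From mathcomp Require Import ring.
From mathcomp.multinomials Require Import monalg.

Set Implicit Arguments.
Unset Strict Implicit.
Unset Printing Implicit Defensive.

Import Order.TTheory GRing.Theory Num.Theory.

Local Open Scope ring_scope.
Local Open Scope quotient_scope.

Section TensorProduct.

Variables (A B : comNzRingType) (phi : {rmorphism A -> B}) (M : lmodType A).

(* A list [:: (m1, b1); ...; (mr, br)] stands for the sum of the mi (x) bi, and
   tensor_eq is the congruence on formal sums presenting the abelian group
   M (x)_A B, where A acts on B through phi. Opposites need no separate
   generators, since - (m (x) b) is represented by (- m, b). *)
Inductive tensor_eq : seq (M * B) -> seq (M * B) -> Prop :=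
| tensor_perm s t : perm_eq s t -> tensor_eq s t
| tensor_sym s t : tensor_eq s t -> tensor_eq t s
| tensor_trans s t u : tensor_eq s t -> tensor_eq t u -> tensor_eq s u
| tensor_cat s1 t1 s2 t2 :
    tensor_eq s1 t1 -> tensor_eq s2 t2 -> tensor_eq (s1 ++ s2) (t1 ++ t2)
| tensor_0 b : tensor_eq [:: (0, b)] [::]
| tensor_Dl m1 m2 b : tensor_eq [:: (m1 + m2, b)] [:: (m1, b); (m2, b)]
| tensor_Dr m b1 b2 : tensor_eq [:: (m, b1 + b2)] [:: (m, b1); (m, b2)]
| tensor_Z a m b : tensor_eq [:: (a *: m, b)] [:: (m, phi a * b)].

End TensorProduct.

(* B is flat as an A-module through phi: tensoring with B preserves injections
   of A-modules *)
Definition flat_hom (A B : comNzRingType) (phi : {rmorphism A -> B}) : Prop :=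
  forall (M N : lmodType A) (f : {linear M -> N}), injective f ->
  forall s t : seq (M * B),
    tensor_eq phi [seq (f x.1, x.2) | x <- s] [seq (f x.1, x.2) | x <- t] ->
    tensor_eq phi s t.

(* The points of Spec A are the elements of prime_idealr A: classically, every
   prime ideal is a boolean predicate. *)

Section Localization.

Variables (A : comNzRingType) (p : prime_idealr A).

Record denominator := Denominator { den_val : A; den_valP : den_val \notin p }.
HB.instance Definition _ := [isSub for den_val].
HB.instance Definition _ := [Choice of denominator by <:].

Lemma den1_subproof : 1 \notin p.
Proof. by rewrite idealr1. Qed.
Definition den1 := Denominator den1_subproof.

Lemma denM_subproof (s t : denominator) : den_val s * den_val t \notin p.
Proof. by rewrite prime_idealrM negb_or !den_valP. Qed.
Definition denM s t := Denominator (denM_subproof s t).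

Definition loc_eq (x y : A * denominator) : bool :=
  `[< exists u : denominator,
       den_val u * (x.1 * den_val y.2) = den_val u * (y.1 * den_val x.2) >].

Lemma loc_eq_refl : reflexive loc_eq.
Proof. by move=> x; apply/asboolP; exists den1. Qed.

Lemma loc_eq_sym : symmetric loc_eq.
Proof. by move=> x y; apply/asboolP/asboolP => -[u e]; exists u. Qed.

Lemma loc_eq_trans : transitive loc_eq.
Proof.
move=> [b [t ht]] [a [s hs]] [c [r hr]] /asboolP[u /= e1] /asboolP[v /= e2].
apply/asboolP; exists (denM (denM u v) (Denominator ht)) => /=.
move: (den_val u) (den_val v) e1 e2 => {}u {}v e1 e2.
have -> : u * v * t * (a * r) = v * r * (u * (a * t)) by ring.
have -> : u * v * t * (c * s) = u * s * (v * (c * t)) by ring.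
by rewrite e1 -e2; ring.
Qed.

Canonical loc_equiv := EquivRel loc_eq loc_eq_refl loc_eq_sym loc_eq_trans.

Definition localization := {eq_quot loc_eq}.
HB.instance Definition _ : EqQuotient _ loc_eq localization :=
  EqQuotient.on localization.
HB.instance Definition _ := Choice.on localization.

Lemma loc_eqP (x y : A * denominator) :
  reflect (exists u : denominator,
       den_val u * (x.1 * den_val y.2) = den_val u * (y.1 * den_val x.2))
          (x == y %[mod localization]).
Proof. by rewrite eqmodE; apply: asboolP. Qed.

Lemma loc_reprP (x : A * denominator) :
  exists u : denominator,
    den_val u * ((repr (\pi_localization x)).1 * den_val x.2) =
    den_val u * (x.1 * den_val (repr (\pi_localization x)).2).
Proof. by apply/loc_eqP; rewrite reprK. Qed.

Definition to_loc : A -> localization :=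
  lift_embed localization (fun a : A => (a, den1)).
Canonical to_loc_pi_morph := PiEmbed to_loc.

Definition loc_addf (x y : A * denominator) : A * denominator :=
  (x.1 * den_val y.2 + y.1 * den_val x.2, denM x.2 y.2).
Definition loc_add := lift_op2 localization loc_addf.
Lemma pi_loc_add : {morph \pi_localization : x y / loc_addf x y >-> loc_add x y}.
Proof.
move=> x y; unlock loc_add; apply/eqP/loc_eqP => /=.
have [u eu] := loc_reprP x; have [v ev] := loc_reprP y.
set x' := repr _ in eu *; set y' := repr _ in ev *.
exists (denM u v) => /=.
move: x'.1 (den_val x'.2) y'.1 (den_val y'.2) eu ev => a' s' b' t'.
move: x.1 (den_val x.2) y.1 (den_val y.2) (den_val u) (den_val v).
move=> a s b t {}u {}v eu ev.
transitivity (v * t * t' * (u * (a * s')) + u * s * s' * (v * (b * t'))).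
  by ring.
by rewrite -eu -ev; ring.
Qed.
Canonical pi_loc_add_morph := PiMorph2 pi_loc_add.

Definition loc_oppf (x : A * denominator) : A * denominator := (- x.1, x.2).
Definition loc_opp := lift_op1 localization loc_oppf.
Lemma pi_loc_opp : {morph \pi_localization : x / loc_oppf x >-> loc_opp x}.
Proof.
move=> x; unlock loc_opp; apply/eqP/loc_eqP => /=.
have [u eu] := loc_reprP x; exists u.
by rewrite !mulNr !mulrN -eu.
Qed.
Canonical pi_loc_opp_morph := PiMorph1 pi_loc_opp.

Definition loc_mulf (x y : A * denominator) : A * denominator :=
  (x.1 * y.1, denM x.2 y.2).
Definition loc_mul := lift_op2 localization loc_mulf.
Lemma pi_loc_mul : {morph \pi_localization : x y / loc_mulf x y >-> loc_mul x y}.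
Proof.
move=> x y; unlock loc_mul; apply/eqP/loc_eqP => /=.
have [u eu] := loc_reprP x; have [v ev] := loc_reprP y.
set x' := repr _ in eu *; set y' := repr _ in ev *.
exists (denM u v) => /=.
move: x'.1 (den_val x'.2) y'.1 (den_val y'.2) eu ev => a' s' b' t'.
move: x.1 (den_val x.2) y.1 (den_val y.2) (den_val u) (den_val v).
move=> a s b t {}u {}v eu ev.
transitivity ((u * (a * s')) * (v * (b * t'))); first by ring.
by rewrite -eu -ev; ring.
Qed.
Canonical pi_loc_mul_morph := PiMorph2 pi_loc_mul.

Lemma loc_addA : associative loc_add.
Proof.
elim/quotW=> x; elim/quotW=> y; elim/quotW=> z; rewrite !piE.
by apply/eqP/loc_eqP; exists den1 => /=; ring.
Qed.

Lemma loc_addC : commutative loc_add.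
Proof.
elim/quotW=> x; elim/quotW=> y; rewrite !piE.
by apply/eqP/loc_eqP; exists den1 => /=; ring.
Qed.

Lemma loc_add0 : left_id (to_loc 0) loc_add.
Proof.
elim/quotW=> x; rewrite !piE.
by apply/eqP/loc_eqP; exists den1 => /=; ring.
Qed.

Lemma loc_addN : left_inverse (to_loc 0) loc_opp loc_add.
Proof.
elim/quotW=> x; rewrite !piE.
by apply/eqP/loc_eqP; exists den1 => /=; ring.
Qed.

HB.instance Definition _ := GRing.isZmodule.Build localization
  loc_addA loc_addC loc_add0 loc_addN.

Lemma loc_mulA : associative loc_mul.
Proof.
elim/quotW=> x; elim/quotW=> y; elim/quotW=> z; rewrite !piE.
by apply/eqP/loc_eqP; exists den1 => /=; ring.
Qed.

Lemma loc_mulC : commutative loc_mul.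
Proof.
elim/quotW=> x; elim/quotW=> y; rewrite !piE.
by apply/eqP/loc_eqP; exists den1 => /=; ring.
Qed.

Lemma loc_mul1 : left_id (to_loc 1) loc_mul.
Proof.
elim/quotW=> x; rewrite !piE.
by apply/eqP/loc_eqP; exists den1 => /=; ring.
Qed.

Lemma loc_mulDl : left_distributive loc_mul loc_add.
Proof.
elim/quotW=> x; elim/quotW=> y; elim/quotW=> z; rewrite !piE.
by apply/eqP/loc_eqP; exists den1 => /=; ring.
Qed.

Lemma loc_1_neq0 : to_loc 1 != to_loc 0.
Proof.
rewrite !piE; apply/negP => /asboolP[u /=].
by rewrite mul0r !mulr1 mulr0 => u0; have := den_valP u; rewrite u0 idealr0.
Qed.

HB.instance Definition _ := GRing.Zmodule_isComNzRing.Build localization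
  loc_mulA loc_mulC loc_mul1 loc_mulDl loc_1_neq0.

End Localization.

Section LocalHom.

Variables (A B : comNzRingType) (phi : {rmorphism A -> B}) (q : prime_idealr B).

Definition preim_ideal : A -> bool := fun a => phi a \in q.

Lemma preim_idealE a : (a \in preim_ideal) = (phi a \in q).
Proof. by []. Qed.

Lemma preim_ideal_idealr : idealr_closed preim_ideal.
Proof.
split; rewrite ?preim_idealE ?rmorph0 ?rmorph1 ?idealr0 ?idealr1 //.
move=> a u v; rewrite !preim_idealE => qu qv.
by rewrite rmorphD rmorphM rpredD // idealMr.
Qed.
HB.instance Definition _ := isIdealr.Build A preim_ideal preim_ideal_idealr.

Lemma preim_ideal_prime : prime_idealr_closed preim_ideal.
Proof. by move=> u v; rewrite !preim_idealE rmorphM prime_idealrM. Qed.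
HB.instance Definition _ :=
  isPrimeIdealrClosed.Build A preim_ideal preim_ideal_prime.

(* the image of the point q under Spec phi : Spec B -> Spec A *)
Definition spec_map : prime_idealr A := preim_ideal : PrimeIdealr.type A.

Lemma den_map_subproof (s : denominator spec_map) : phi (den_val s) \notin q.
Proof. exact: (den_valP s). Qed.
Definition den_map s := Denominator (den_map_subproof s).

(* the homomorphism of stalks A_(phi^-1 q) -> B_q, a / s |-> phi a / phi s *)
Definition stalk_mapf (x : A * denominator spec_map) : B * denominator q :=
  (phi x.1, den_map x.2).
Definition stalk_map (x : localization spec_map) : localization q :=
  \pi_(localization q) (stalk_mapf (repr x)).

Lemma stalk_map_pi x :
  stalk_map (\pi_(localization spec_map) x) = \pi_(localization q) (stalk_mapf x).
Proof.
have [u eu] := loc_reprP x; apply/eqP/loc_eqP; exists (den_map u) => /=.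
by rewrite -!rmorphM eu.
Qed.

Lemma stalk_map_zmod : zmod_morphism stalk_map.
Proof.
elim/quotW=> x; elim/quotW=> y.
have -> : \pi_(localization spec_map) x - \pi_(localization spec_map) y
    = \pi_(localization spec_map) (loc_addf x (loc_oppf y)).
  by rewrite -[- _]pi_loc_opp -[_ + _]pi_loc_add.
rewrite !stalk_map_pi -[- _]pi_loc_opp -[RHS]pi_loc_add.
apply/eqP/loc_eqP; exists (den1 q) => /=.
by rewrite !(rmorphD, rmorphN, rmorphM) /=; ring.
Qed.

Lemma stalk_map_monoid : monoid_morphism stalk_map.
Proof.
split.
  rewrite /GRing.one /= !piE stalk_map_pi; apply/eqP/loc_eqP.
  by exists (den1 q); rewrite /= rmorph1; ring.
elim/quotW=> x; elim/quotW=> y.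
rewrite -[X in stalk_map X]pi_loc_mul !stalk_map_pi -[RHS]pi_loc_mul.
by apply/eqP/loc_eqP; exists (den1 q) => /=; rewrite !rmorphM /=; ring.
Qed.

HB.instance Definition _ := GRing.isZmodMorphism.Build
  (localization spec_map) (localization q) stalk_map stalk_map_zmod.
HB.instance Definition _ := GRing.isMonoidMorphism.Build
  (localization spec_map) (localization q) stalk_map stalk_map_monoid.

End LocalHom.

(* malg is the free module on a type; the library only makes it a ring over
   monoids without nontrivial units, which excludes lattices. *)
Definition monoid_algebra (k : comNzRingType) (S : nmodType) := {malg k[S]}.

HB.instance Definition _ k S := GRing.Lmodule.on (monoid_algebra k S).

Section MonoidAlgebra.

Variables (k : comNzRingType) (S : nmodType).

Local Notation kS := (monoid_algebra k S).

Implicit Types f g : kS.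

Definition mono (c : k) (m : S) : kS := mkmalgU m c.

Definition ma_mul f g : kS :=
  \sum_(m1 <- msupp f) \sum_(m2 <- msupp g)
     mono (mcoeff m1 f * mcoeff m2 g) (m1 + m2).

Lemma mono0 m : mono 0 m = 0.
Proof. exact: monalgU0. Qed.

Lemma monoD c d m : mono (c + d) m = mono c m + mono d m.
Proof. exact: monalgUD. Qed.

Lemma ma_sumE f : f = \sum_(m <- msupp f) mono (mcoeff m f) m.
Proof. exact: monalgE. Qed.

Lemma ma_mulw (d1 d2 : {fset S}) f g :
  (msupp f `<=` d1)%fset -> (msupp g `<=` d2)%fset ->
  ma_mul f g = \sum_(m1 <- d1) \sum_(m2 <- d2)
     mono (mcoeff m1 f * mcoeff m2 g) (m1 + m2).
Proof.
move=> le1 le2; rewrite /ma_mul (big_fset_incl _ le1) /=.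
  apply/eq_bigr=> m1 _; apply/big_fset_incl => // m _ /mcoeff_outdom ->.
  by rewrite mulr0 mono0.
by move=> m _ /mcoeff_outdom h; rewrite big1 // => m' _; rewrite h mul0r mono0.
Qed.

Lemma ma_mulDl : left_distributive ma_mul +%R.
Proof.
move=> f g h; have le := fsubset_refl (msupp h).
rewrite (ma_mulw (msuppD_le f g) le) (ma_mulw (fsubsetUl _ (msupp g)) le).
rewrite (ma_mulw (fsubsetUr (msupp f) _) le) -big_split /=.
apply/eq_bigr=> m1 _; rewrite -big_split /=; apply/eq_bigr=> m2 _.
by rewrite -monoD -mulrDl -mcoeffD.
Qed.

Lemma ma_mulC : commutative ma_mul.
Proof.
move=> f g; rewrite /ma_mul exchange_big /=; apply/eq_bigr=> m2 _.
by apply/eq_bigr=> m1 _; rewrite mulrC addrC.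
Qed.

Lemma ma_mulDr : right_distributive ma_mul +%R.
Proof. by move=> f g h; rewrite !(ma_mulC f) ma_mulDl. Qed.

Lemma ma_mul0 f : ma_mul 0 f = 0.
Proof. by rewrite /ma_mul msupp0 big_seq_fset0. Qed.

Lemma ma_mulr0 f : ma_mul f 0 = 0.
Proof. by rewrite ma_mulC ma_mul0. Qed.

Lemma ma_mul_mono c d m1 m2 :
  ma_mul (mono c m1) (mono d m2) = mono (c * d) (m1 + m2).
Proof. by rewrite (ma_mulw msuppU_le msuppU_le) !big_seq_fset1 !mcoeffUU. Qed.

Lemma ma_mul_suml I (r : seq I) (F : I -> kS) g :
  ma_mul (\sum_(i <- r) F i) g = \sum_(i <- r) ma_mul (F i) g.
Proof.
exact: (big_morph (ma_mul^~ g) (fun f1 f2 => ma_mulDl f1 f2 g) (ma_mul0 g)).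
Qed.

Lemma ma_mul_sumr I (r : seq I) (F : I -> kS) g :
  ma_mul g (\sum_(i <- r) F i) = \sum_(i <- r) ma_mul g (F i).
Proof. exact: (big_morph (ma_mul g) (ma_mulDr g) (ma_mulr0 g)). Qed.

Lemma ma_mulA : associative ma_mul.
Proof.
move=> f g h; rewrite (ma_sumE f) (ma_sumE g) (ma_sumE h).
rewrite !ma_mul_suml; apply/eq_bigr=> m1 _.
rewrite [X in _ = ma_mul X _]ma_mul_sumr [RHS]ma_mul_suml [LHS]ma_mul_sumr.
apply/eq_bigr=> m2 _.
rewrite !ma_mul_sumr; apply/eq_bigr=> m3 _.
by rewrite !ma_mul_mono mulrA addrA.
Qed.

Lemma ma_mul1 : left_id (mono 1 0) ma_mul.
Proof.
move=> f; rewrite [in LHS](ma_sumE f) ma_mul_sumr [RHS]ma_sumE.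
by apply/eq_bigr=> m _; rewrite ma_mul_mono mul1r add0r.
Qed.

Lemma ma_1_neq0 : mono 1 0 != 0.
Proof.
by apply/eqP/malgP=> /(_ 0) /eqP; rewrite mcoeffUU mcoeff0 oner_eq0.
Qed.

HB.instance Definition _ := GRing.Zmodule_isComNzRing.Build kS
  ma_mulA ma_mulC ma_mul1 ma_mulDl ma_1_neq0.

End MonoidAlgebra.

Section MonoidAlgebraMap.

Variables (k : comNzRingType) (S T : nmodType) (h : {additive S -> T}).

Definition ma_map (f : monoid_algebra k S) : monoid_algebra k T :=
  \sum_(m <- msupp f) mono (mcoeff m f) (h m).

Lemma ma_mapw (d : {fset S}) f : (msupp f `<=` d)%fset ->
  ma_map f = \sum_(m <- d) mono (mcoeff m f) (h m).
Proof.
by move=> le; apply/big_fset_incl => // m _ /mcoeff_outdom ->; rewrite mono0.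
Qed.

Lemma ma_mapD : {morph ma_map : f g / f + g}.
Proof.
move=> f g; rewrite (ma_mapw (msuppD_le f g)).
rewrite (ma_mapw (fsubsetUl _ (msupp g))) (ma_mapw (fsubsetUr (msupp f) _)).
by rewrite -big_split /=; apply/eq_bigr=> m _; rewrite -monoD -mcoeffD.
Qed.

Lemma ma_map0 : ma_map 0 = 0.
Proof. by rewrite /ma_map msupp0 big_seq_fset0. Qed.

Lemma ma_map_zmod : zmod_morphism ma_map.
Proof.
by move=> f g; apply/(addIr (ma_map g)); rewrite -ma_mapD !subrK.
Qed.

Lemma ma_map_mono c m : ma_map (mono c m) = mono c (h m).
Proof. by rewrite (ma_mapw msuppU_le) big_seq_fset1 mcoeffUU. Qed.

Lemma ma_map_sum I (r : seq I) (F : I -> monoid_algebra k S) :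
  ma_map (\sum_(i <- r) F i) = \sum_(i <- r) ma_map (F i).
Proof. exact: (big_morph ma_map ma_mapD ma_map0). Qed.

Lemma ma_map_monoid : monoid_morphism ma_map.
Proof.
split; first by rewrite [LHS]ma_map_mono raddf0.
move=> f g; rewrite [ma_map (f * g)]ma_map_sum [RHS]ma_mul_suml.
apply/eq_bigr=> m1 _; rewrite ma_map_sum ma_mul_sumr; apply/eq_bigr=> m2 _.
by rewrite ma_map_mono ma_mul_mono raddfD.
Qed.

HB.instance Definition _ := GRing.isZmodMorphism.Build
  (monoid_algebra k S) (monoid_algebra k T) ma_map ma_map_zmod.
HB.instance Definition _ := GRing.isMonoidMorphism.Build
  (monoid_algebra k S) (monoid_algebra k T) ma_map ma_map_monoid.

End MonoidAlgebraMap.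

(* A root system Phi is given by vectors with integral coordinates spanning
   R^n. Then M is the subgroup of Z^n generated by Phi, the space N_R is
   identified with R^n by the standard pairing, and N is the set of the v such
   that pairing m v is an integer for all m in M. *)

Definition pairing (R : realType) n (m : 'rV[int]_n) (v : 'rV[R]_n) : R :=
  \sum_(i < n) (m 0 i)%:~R * v 0 i.

Definition root_lattice n (Phi : set 'rV[int]_n) (m : 'rV[int]_n) : Prop :=
  exists2 s : seq (int * 'rV[int]_n),
    (forall x, x \in s -> Phi x.2) & m = \sum_(x <- s) x.2 *~ x.1.

Section Fan.

Variables (R : realType) (n : nat) (Phi : set 'rV[int]_n).

Definition regular_vector (v : 'rV[R]_n) : Prop :=
  forall a, Phi a -> pairing a v != 0.

(* the closure of the connected component of v0 in the complement of the root
   hyperplanes, for regular v0 *)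
Definition closed_chamber (v0 : 'rV[R]_n) : set 'rV[R]_n :=
  [set v | forall a, Phi a -> 0 < pairing a v0 -> 0 <= pairing a v]%classic.

Definition is_face (tau sigma : set 'rV[R]_n) : Prop :=
  exists u : 'rV[R]_n,
    (forall v, sigma v -> 0 <= \sum_i u 0 i * v 0 i) /\
    tau = [set v | sigma v /\ \sum_i u 0 i * v 0 i = 0]%classic.

Definition weyl_fan : set (set 'rV[R]_n) :=
  [set tau | exists2 v0, regular_vector v0 & is_face tau (closed_chamber v0)]%classic.

Definition dual_monoid_pred (sigma : set 'rV[R]_n) : 'rV[int]_n -> bool :=
  fun m => `[< root_lattice Phi m /\ forall v, sigma v -> 0 <= pairing m v >].

End Fan.

Lemma pairing0l (R : realType) n (v : 'rV[R]_n) : pairing 0 v = 0.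
Proof. by rewrite /pairing big1 // => i _; rewrite mxE mul0r. Qed.

Lemma pairingDl (R : realType) n (m1 m2 : 'rV[int]_n) (v : 'rV[R]_n) :
  pairing (m1 + m2) v = pairing m1 v + pairing m2 v.
Proof.
by rewrite /pairing -big_split /=; apply: eq_bigr => i _; rewrite mxE intrD mulrDl.
Qed.

Section DualMonoid.

Variables (R : realType) (n : nat) (Phi : set 'rV[int]_n).
Variable sigma : set 'rV[R]_n.

Lemma dual_monoid_add : addr_closed (dual_monoid_pred Phi sigma).
Proof.
split; first apply/asboolP.
  split; last by move=> v _; rewrite pairing0l.
  by exists [::] => //; rewrite big_nil.
move=> m1 m2 /asboolP[[s1 P1 ->] h1] /asboolP[[s2 P2 ->] h2]; apply/asboolP.
split; last by move=> v sv; rewrite pairingDl addr_ge0 ?h1 ?h2.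
exists (s1 ++ s2); last by rewrite big_cat.
by move=> x; rewrite mem_cat => /orP[/P1|/P2].
Qed.

(* the commutative monoid consisting of the m in M that are nonnegative on
   sigma *)
Record dual_monoid := DualMonoid
  { dual_val : 'rV[int]_n; dual_valP : dual_val \in dual_monoid_pred Phi sigma }.
HB.instance Definition _ := [isSub for dual_val].
HB.instance Definition _ := [Choice of dual_monoid by <:].
HB.instance Definition _ := 
  GRing.SubChoice_isSubNmodule.Build 'rV[int]_n _ dual_monoid dual_monoid_add.

End DualMonoid.

(* an inclusion of root systems, given by the inclusion of lattices
   Z^n -> Z^n' mapping Phi into Phi', together with its dual N'_R -> N_R *)
Record root_inclusion (R : realType) n n' (Phi : set 'rV[int]_n)
    (Phi' : set 'rV[int]_n') := RootInclusion {
  incl : {additive 'rV[int]_n -> 'rV[int]_n'};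
  incl_inj : injective incl;
  incl_root : forall a, Phi a -> Phi' (incl a);
  incl_dual : 'rV[R]_n' -> 'rV[R]_n;
  incl_adj : forall m v, pairing (incl m) v = pairing m (incl_dual v)
}.

Section ToricVariety.

Variables (k : fieldType) (R : realType) (n : nat) (Phi : set 'rV[int]_n).

(* k[sigma^dual :&: M], the coordinate ring of the affine toric variety
   U_sigma *)
Definition chart_ring (sigma : set 'rV[R]_n) : comNzRingType :=
  monoid_algebra k (dual_monoid Phi sigma).

(* X(Phi) is obtained by gluing the U_sigma = Spec (chart_ring sigma), for
   sigma in the fan, along their common faces. A point of X(Phi) is given by a
   chart U_sigma and a point of U_sigma; the same point may be given in several
   charts, and then the stalks of the structure sheaf computed in these charts
   are canonically isomorphic. *)
Record toric_point := ToricPoint {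
  chart : set 'rV[R]_n;
  chart_fan : weyl_fan Phi chart;
  chart_point : prime_idealr (chart_ring chart)
}.

Definition toric_stalk (x : toric_point) : comNzRingType :=
  localization (chart_point x).

End ToricVariety.

Section ToricMorphism.

Variables (k : fieldType) (R : realType) (n n' : nat).
Variables (Phi : set 'rV[int]_n) (Phi' : set 'rV[int]_n').
Variable E : root_inclusion R Phi Phi'.

Definition maps_into (sigma' : set 'rV[R]_n') (sigma : set 'rV[R]_n) : Prop :=
  forall v, sigma' v -> sigma (incl_dual E v).

Lemma weyl_fan_compat sigma' : weyl_fan Phi' sigma' ->
  exists2 sigma, weyl_fan Phi sigma & maps_into sigma' sigma.
Proof.
move=> [v0 reg0 [u [_ ->]]]; exists (closed_chamber Phi (incl_dual E v0)).
  exists (incl_dual E v0).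
    by move=> a Pa; rewrite -incl_adj; apply: reg0; apply: incl_root.
  exists 0; split=> [v _|].
    by rewrite big1 // => i _; rewrite mxE mul0r.
  apply/seteqP; split=> v /=; last by case.
  by move=> sv; split=> //; rewrite big1 // => i _; rewrite mxE mul0r.
move=> v /= [sv _] a Pa; rewrite -!incl_adj; apply: sv; exact: incl_root.
Qed.

Section Chart.

Variables (sigma' : set 'rV[R]_n') (sigma : set 'rV[R]_n).
Hypothesis h : maps_into sigma' sigma.

Lemma dual_map_subproof (m : dual_monoid Phi sigma) :
  incl E (dual_val m) \in dual_monoid_pred Phi' sigma'.
Proof.
have /asboolP[[s Ps ms] pos] := dual_valP m; apply/asboolP; split.
  exists [seq (x.1, incl E x.2) | x <- s].
    by move=> _ /mapP[x xs ->]; exact: (incl_root E (Ps x xs)).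
  by rewrite ms raddf_sum big_map; apply: eq_bigr => x _; rewrite raddfMz.
by move=> v sv; rewrite incl_adj; exact: pos (h sv).
Qed.

Definition dual_map (m : dual_monoid Phi sigma) : dual_monoid Phi' sigma' :=
  DualMonoid (dual_map_subproof m).

Lemma dual_map_nmod : nmod_morphism dual_map.
Proof.
by split=> [|m1 m2]; apply: val_inj; rewrite /= ?raddf0 ?raddfD.
Qed.
HB.instance Definition _ := GRing.isNmodMorphism.Build
  (dual_monoid Phi sigma) (dual_monoid Phi' sigma') dual_map dual_map_nmod.

(* the comorphism of U_sigma' -> U_sigma, mapping the character m to the
   character incl E m *)
Definition chart_map : {rmorphism chart_ring k Phi sigma -> chart_ring k Phi' sigma'} :=
  @ma_map k _ _ dual_map.

End Chart.

(* the image of x, given in the chart U_sigma *)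
Definition toric_image (x : toric_point k R Phi') (sigma : set 'rV[R]_n)
    (hsigma : weyl_fan Phi sigma) (h : maps_into (chart x) sigma) :
    toric_point k R Phi :=
  ToricPoint hsigma (spec_map (chart_map h) (chart_point x)).

Definition toric_stalk_map (x : toric_point k R Phi') (sigma : set 'rV[R]_n)
    (hsigma : weyl_fan Phi sigma) (h : maps_into (chart x) sigma) :
    {rmorphism toric_stalk (toric_image hsigma h) -> toric_stalk x} :=
  @stalk_map _ _ (chart_map h) (chart_point x).

(* flatness of the toric morphism X(Phi') -> X(Phi) induced by E: all the
   homomorphisms of stalks are flat *)
Definition toric_morphism_flat : Prop :=
  forall (x : toric_point k R Phi') (sigma : set 'rV[R]_n)
    (hsigma : weyl_fan Phi sigma) (h : maps_into (chart x) sigma),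
    flat_hom (toric_stalk_map hsigma h).

End ToricMorphism.

Definition rootsD n : set 'rV[int]_n :=
  [set a | exists i j : 'I_n, (i < j)%N /\ exists e e' : bool,
     a = (-1) ^+ e *: delta_mx 0 i + (-1) ^+ e' *: delta_mx 0 j]%classic.

Section InclusionD.

Variables (R : realType) (n : nat).

Definition inclD (m : 'rV[int]_n) : 'rV[int]_(n + 1) := row_mx m 0.

Lemma inclD_zmod : zmod_morphism inclD.
Proof. by move=> m1 m2; rewrite /inclD opp_row_mx add_row_mx subr0. Qed.
HB.instance Definition _ := GRing.isZmodMorphism.Build
  'rV[int]_n 'rV[int]_(n + 1) inclD inclD_zmod.

Lemma inclD_inj : injective inclD.
Proof. by move=> m1 m2 /eq_row_mx[]. Qed.

Lemma inclD_root a : rootsD a -> rootsD (inclD a).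
Proof.
move=> [i [j [ij [e [e' ->]]]]].
exists (lshift 1 i), (lshift 1 j); split=> //; exists e, e'.
by rewrite !delta_mx_lshift /inclD !scale_row_mx !scaler0 add_row_mx addr0.
Qed.

Lemma inclD_adj (m : 'rV[int]_n) (v : 'rV[R]_(n + 1)) :
  pairing (inclD m) v = pairing m (lsubmx v).
Proof.
rewrite /pairing big_split_ord /= [X in _ + X]big1 ?addr0; last first.
  by move=> i _; rewrite /inclD row_mxEr mxE mul0r.
by apply: eq_bigr => i _; rewrite /inclD row_mxEl !mxE.
Qed.

Definition inclusionD : root_inclusion R (@rootsD n) (@rootsD (n + 1)) :=
  RootInclusion inclD_inj inclD_root inclD_adj.

End InclusionD.

(* Main.v *)
(** The dominant chamber sigma' of D_{n+1} maps into the dominant chamber sigma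
    of D_n.  Let x and y be the characters u_{n-1} - u_n and u_{n-1} + u_n, two
    of the coordinates on U_sigma.  On U_sigma' the character w = 2 u_n is
    regular, being the sum of the roots u_n - u_{n+1} and u_n + u_{n+1}, so
    x w = y there.  Flatness would force the relation (w, -1) between x and y to
    be a combination of relations over the base, hence y to lie in the ideal (x)
    of the local ring at the image of the fixed point of U_sigma'; it does
    not. *)
Require Import Defs.
From HB Require Import structures.
From mathcomp Require Import all_boot all_order all_algebra.
From mathcomp Require Import finmap generic_quotient ring_quotient.
From mathcomp Require Import boolp classical_sets reals.
From mathcomp Require Import ring lra zify.
From mathcomp.multinomials Require Import monalg.

Set Implicit Arguments.
Unset Strict Implicit.
Unset Printing Implicit Defensive.

Import Order.TTheory GRing.Theory Num.Theory.

Local Open Scope ring_scope.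
Local Open Scope quotient_scope.

(** * The ideal generated by two elements, as a module *)

Section TwoGenerators.

Variables (A : comNzRingType) (x y : A).

Definition span2_pred : {pred A^o} :=
  fun z => `[< exists r s : A, z = r * x + s * y >].

Lemma span2_closed : submod_closed span2_pred.
Proof.
split; first by apply/asboolP; exists 0, 0; rewrite !mul0r addr0.
move=> a _ _ /asboolP[r [s ->]] /asboolP[r' [s' ->]]; apply/asboolP.
by exists (a * r + r'), (a * s + s'); rewrite /GRing.scale /=; ring.
Qed.

(** Its inclusion into [A^o] is the injection on which flatness is tested. *)
Record span2 := Span2
  { span2_val : A^o; span2_valP : span2_val \in span2_pred }.
HB.instance Definition _ := [isSub for span2_val].
HB.instance Definition _ := [Choice of span2 by <:].
HB.instance Definition _ :=
  GRing.SubChoice_isSubLmodule.Build A A^o span2_pred span2 span2_closed.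

End TwoGenerators.

(** * Flatness and relations between two elements *)

Section FlatRelation.

Variables (A B K : comNzRingType) (phi : {rmorphism A -> B}).
Variables (ev : {rmorphism B -> K}) (x y : A).
Hypothesis syz : forall r s, r * x + s * y = 0 -> ev (phi s) = 0.

Lemma span2_coord (z : span2 x y) :
  {s : A | exists r, span2_val z = r * x + s * y}.
Proof.
by apply: cid; have /asboolP[r [s e]] := span2_valP z; exists s, r.
Qed.

Definition coord2 (z : span2 x y) : K := ev (phi (sval (span2_coord z))).

(** Two representations of [z] differ by a syzygy, whose second entry is killed by [syz]; so the
    choice made in [span2_coord] does not matter. *)
Lemma coord2E z r s : span2_val z = r * x + s * y -> coord2 z = ev (phi s).
Proof.
rewrite /coord2; case: span2_coord => s' /= [r' ->] e; apply/eqP.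
rewrite -subr_eq0 -!rmorphB; apply/eqP/(@syz (r' - r)).
by rewrite !mulrBl addrACA e -opprD subrr.
Qed.

Lemma coord2D z1 z2 : coord2 (z1 + z2) = coord2 z1 + coord2 z2.
Proof.
rewrite [in RHS]/coord2; case: span2_coord => s1 /= [r1 e1].
case: span2_coord => s2 /= [r2 e2]; rewrite -!rmorphD.
by apply: (@coord2E _ (r1 + r2)); rewrite /= e1 e2; ring.
Qed.

Lemma coord2Z a z : coord2 (a *: z) = ev (phi a) * coord2 z.
Proof.
rewrite [in RHS]/coord2; case: span2_coord => s /= [r e]; rewrite -!rmorphM.
by apply: (@coord2E _ (a * r)); rewrite /= e /GRing.scale /=; ring.
Qed.

Lemma coord20 : coord2 0 = 0.
Proof. by rewrite (@coord2E 0 0 0) ?rmorph0 // !mul0r addr0. Qed.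

Definition tensor_coord2 (s : seq (span2 x y * B)) : K :=
  \sum_(p <- s) coord2 p.1 * ev p.2.

(** With A acting on K through [phi] and [ev], the form [coord2 z * ev b] is A-balanced, so it
    descends to the tensor product of (x, y) with B. *)
Lemma tensor_coord2_eq s t :
  tensor_eq phi s t -> tensor_coord2 s = tensor_coord2 t.
Proof.
rewrite /tensor_coord2; elim=> {s t}
  [s t||||b|m1 m2 b|m b1 b2|a m b].
- by move=> st; apply: perm_big.
- by move=> s t _ ->.
- by move=> s t u _ -> _ ->.
- by move=> s1 t1 s2 t2 _ e1 _ e2; rewrite !big_cat /= e1 e2.
- by rewrite big_seq1 big_nil /= coord20 mul0r.
- by rewrite !(big_cons, big_nil) /= !addr0 coord2D mulrDl.
- by rewrite !(big_cons, big_nil) /= !addr0 rmorphD mulrDr.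
- by rewrite !big_seq1 /= coord2Z rmorphM mulrCA mulrA.
Qed.

(* x (x) w and y (x) 1 both equal 1 (x) phi y in A (x) B, but the functional
   (r x + s y) (x) b |-> ev (phi s) * ev b separates them in (x, y) (x) B. *)
Lemma new_relation_not_flat (w : B) : phi x * w = phi y -> ~ flat_hom phi.
Proof.
move=> xw flat.
have xP : (x : A^o) \in span2_pred x y.
  by apply/asboolP; exists 1, 0; rewrite mul1r mul0r addr0.
have yP : (y : A^o) \in span2_pred x y.
  by apply/asboolP; exists 0, 1; rewrite mul1r mul0r add0r.
have unitZ (a : A) (b : B) :
    tensor_eq phi [:: (a : A^o, b)] [:: (1 : A^o, phi a * b)].
  by have := tensor_Z phi a (1 : A^o) b; rewrite /GRing.scale /= mulr1.
have e : tensor_eq phi [:: (Span2 xP, w)] [:: (Span2 yP, 1)].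
  apply: (flat _ A^o (val : span2 x y -> A^o)) => /=; first exact: val_inj.
  apply: tensor_trans (unitZ _ _) _; apply: tensor_sym.
  by apply: tensor_trans (unitZ _ _) _; rewrite xw mulr1; apply: tensor_perm.
have := tensor_coord2_eq e; rewrite /tensor_coord2 !big_seq1 /=.
rewrite (@coord2E _ 1 0) ?(@coord2E _ 0 1) /= ?mul1r ?mul0r ?addr0 ?add0r //.
by rewrite !rmorph0 !rmorph1 mul0r mulr1 => /esym/eqP; rewrite oner_eq0.
Qed.

End FlatRelation.

(** * Local rings at kernels of homomorphisms to a field *)

Section KernelPoint.

Variables (k : fieldType) (B : comNzRingType) (ev : {rmorphism B -> k}).

Definition ker_ideal : B -> bool := fun b => ev b == 0.

Lemma ker_idealE b : (b \in ker_ideal) = (ev b == 0).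
Proof. by []. Qed.

Lemma ker_ideal_idealr : idealr_closed ker_ideal.
Proof.
split; rewrite ?ker_idealE ?rmorph0 ?rmorph1 ?oner_eq0 //.
by move=> a u v; rewrite !ker_idealE rmorphD rmorphM => /eqP-> /eqP->;
  rewrite mulr0 addr0.
Qed.
HB.instance Definition _ := isIdealr.Build B ker_ideal ker_ideal_idealr.

Lemma ker_ideal_prime : prime_idealr_closed ker_ideal.
Proof. by move=> u v; rewrite !ker_idealE rmorphM mulf_eq0. Qed.
HB.instance Definition _ :=
  isPrimeIdealrClosed.Build B ker_ideal ker_ideal_prime.

Definition ker_point : prime_idealr B := ker_ideal : PrimeIdealr.type B.

Lemma ev_den_neq0 (s : denominator ker_point) : ev (den_val s) != 0.
Proof. exact: den_valP s. Qed.

(** The extension of [ev] to the local ring; denominators are by definition the elements with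
    invertible value. *)
Definition ev_loc (z : localization ker_point) : k :=
  ev (repr z).1 / ev (den_val (repr z).2).

Lemma ev_loc_pi z :
  ev_loc (\pi_(localization ker_point) z) = ev z.1 / ev (den_val z.2).
Proof.
have [u /(congr1 ev)] := loc_reprP z; rewrite !rmorphM.
move=> /(mulfI (ev_den_neq0 u)) e.
by apply/eqP; rewrite eqr_div ?ev_den_neq0 // e.
Qed.

Lemma ev_loc_zmod : zmod_morphism ev_loc.
Proof.
elim/quotW=> z1; elim/quotW=> z2.
have -> : \pi_(localization ker_point) z1 - \pi_(localization ker_point) z2
    = \pi_(localization ker_point) (loc_addf z1 (loc_oppf z2)).
  by rewrite -[- _]pi_loc_opp -[_ + _]pi_loc_add.
rewrite !ev_loc_pi /= !(rmorphD, rmorphN, rmorphM) /= -mulNr.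
by rewrite addf_div ?ev_den_neq0.
Qed.

Lemma ev_loc_monoid : monoid_morphism ev_loc.
Proof.
split.
  by rewrite /GRing.one /= !piE ev_loc_pi /= !rmorph1 divr1.
elim/quotW=> z1; elim/quotW=> z2.
by rewrite -[X in ev_loc X]pi_loc_mul !ev_loc_pi /= !rmorphM mulf_div.
Qed.

HB.instance Definition _ := GRing.isZmodMorphism.Build
  (localization ker_point) k ev_loc ev_loc_zmod.
HB.instance Definition _ := GRing.isMonoidMorphism.Build
  (localization ker_point) k ev_loc ev_loc_monoid.

End KernelPoint.

(** * Stalk maps that are not flat *)

Lemma pi_locM (A : comNzRingType) (p : prime_idealr A) x y :
  \pi_(localization p) x * \pi_(localization p) y
  = \pi_(localization p) (loc_mulf x y).
Proof. exact/esym/pi_loc_mul. Qed.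

Lemma pi_locD (A : comNzRingType) (p : prime_idealr A) x y :
  \pi_(localization p) x + \pi_(localization p) y
  = \pi_(localization p) (loc_addf x y).
Proof. exact/esym/pi_loc_add. Qed.

Lemma to_locE (A : comNzRingType) (p : prime_idealr A) a :
  to_loc p a = \pi_(localization p) (a, den1 p).
Proof. by rewrite piE. Qed.

Lemma to_locM (A : comNzRingType) (p : prime_idealr A) :
  {morph @to_loc A p : a b / a * b}.
Proof.
move=> a b; rewrite !to_locE pi_locM; apply/eqP/loc_eqP.
by exists (den1 p) => /=; rewrite !mulr1.
Qed.

(** The second hypothesis says that the colon ideal ((x) : y) lies in the prime [p] below the kernel
    of [ev], that is, y is not in the ideal (x) of the local ring at [p]. *)
Lemma stalk_map_not_flat (k : fieldType) (A B : comNzRingType)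
    (phi : {rmorphism A -> B}) (ev : {rmorphism B -> k}) (x y : A) (w : B) :
  phi x * w = phi y ->
  (forall u a, u * y = x * a -> ev (phi u) = 0) ->
  ~ flat_hom (@stalk_map _ _ phi (ker_point ev)).
Proof.
move=> xw yx; set p := spec_map phi (ker_point ev).
have to_loc_map a : stalk_map (to_loc p a) = to_loc (ker_point ev) (phi a).
  rewrite !to_locE stalk_map_pi; apply/eqP/loc_eqP.
  by exists (den1 _) => /=; rewrite rmorph1; ring.
apply: (@new_relation_not_flat _ _ _ _ (ev_loc (ev := ev))
          (to_loc p x) (to_loc p y) _ (to_loc _ w)); last first.
  by rewrite [X in X * _]to_loc_map [RHS]to_loc_map -to_locM xw.
elim/quotW=> -[a d]; elim/quotW=> -[b e].
have evE : ev_loc (stalk_map (\pi_(localization p) (b, e)))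
    = ev (phi b) / ev (phi (den_val e)) by rewrite stalk_map_pi ev_loc_pi.
rewrite !to_locE !pi_locM pi_locD -[0]/(to_loc p 0) to_locE.
move=> /eqP/loc_eqP[u /= eq]; rewrite [LHS]evE.
suff : ev (phi (den_val u * den_val d * b)) = 0.
  have ev_den (t : denominator p) : ev (phi (den_val t)) != 0.
    exact: den_valP t.
  rewrite !rmorphM => /eqP; rewrite !mulf_eq0 !(negbTE (ev_den _)) /=.
  by move=> /eqP ->; rewrite mul0r.
(* Cleared of denominators, (a/d) x + (b/e) y = 0 reads (u d b) y = - (u a e) x. *)
apply: (yx _ (- (den_val u * a * den_val e))).
rewrite mul0r mulr0 !mulr1 in eq.
by apply/eqP; rewrite -subr_eq0 -{}eq; apply/eqP; ring.
Qed.

(** * Evaluation of monoid algebras at characters *)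

Section MonoidAlgebraEval.

Variables (k : comNzRingType) (S : nmodType) (chi : S -> k).
Hypothesis chi0 : chi 0 = 1.
Hypothesis chiD : {morph chi : m1 m2 / m1 + m2 >-> m1 * m2}.

Definition ma_eval (f : monoid_algebra k S) : k :=
  \sum_(m <- msupp f) mcoeff m f * chi m.

Lemma ma_evalw (d : {fset S}) f : (msupp f `<=` d)%fset ->
  ma_eval f = \sum_(m <- d) mcoeff m f * chi m.
Proof.
by move=> le; apply/big_fset_incl => // m _ /mcoeff_outdom ->; rewrite mul0r.
Qed.

Lemma ma_evalD : {morph ma_eval : f g / f + g}.
Proof.
move=> f g; rewrite (ma_evalw (msuppD_le f g)).
rewrite (ma_evalw (fsubsetUl _ (msupp g))) (ma_evalw (fsubsetUr (msupp f) _)).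
by rewrite -big_split /=; apply/eq_bigr=> m _; rewrite -mulrDl -mcoeffD.
Qed.

Lemma ma_eval0 : ma_eval 0 = 0.
Proof. by rewrite /ma_eval msupp0 big_seq_fset0. Qed.

Lemma ma_eval_zmod : zmod_morphism ma_eval.
Proof.
by move=> f g; apply/(addIr (ma_eval g)); rewrite -ma_evalD !subrK.
Qed.

Lemma ma_eval_mono c m : ma_eval (mono c m) = c * chi m.
Proof. by rewrite (ma_evalw msuppU_le) big_seq_fset1 mcoeffUU. Qed.

Lemma ma_eval_sum I (r : seq I) (F : I -> monoid_algebra k S) :
  ma_eval (\sum_(i <- r) F i) = \sum_(i <- r) ma_eval (F i).
Proof. exact: (big_morph ma_eval ma_evalD ma_eval0). Qed.

Lemma ma_eval_monoid : monoid_morphism ma_eval.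
Proof.
split; first by rewrite [LHS]ma_eval_mono chi0 mulr1.
move=> f g; rewrite [ma_eval (f * g)]ma_eval_sum mulr_suml.
apply/eq_bigr=> m1 _; rewrite ma_eval_sum mulr_sumr; apply/eq_bigr=> m2 _.
by rewrite ma_eval_mono chiD mulrACA.
Qed.

HB.instance Definition _ := GRing.isZmodMorphism.Build
  (monoid_algebra k S) k ma_eval ma_eval_zmod.
HB.instance Definition _ := GRing.isMonoidMorphism.Build
  (monoid_algebra k S) k ma_eval ma_eval_monoid.

Definition ma_evalM : {rmorphism monoid_algebra k S -> k} := ma_eval.

End MonoidAlgebraEval.

Lemma ma_eval_map_eq0 (k : comNzRingType) (S T : nmodType) (chi : T -> k)
    (h : {additive S -> T}) (f : monoid_algebra k S) :
  (forall m, m \in msupp f -> chi (h m) = 0) -> ma_eval chi (ma_map h f) = 0.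
Proof.
move=> chi0; rewrite ma_eval_sum big_seq big1 // => m /chi0 e.
by rewrite ma_eval_mono e mulr0.
Qed.

Lemma ma_map_mono1M (k : comNzRingType) (S T : nmodType)
    (h : {additive S -> T}) m1 m2 w :
  h m1 + w = h m2 ->
  ma_map h (mono (1 : k) m1) * mono 1 w = ma_map h (mono 1 m2).
Proof. by move=> e; rewrite !ma_map_mono [LHS]ma_mul_mono mulr1 e. Qed.

(** * Supports of multiples of a monomial *)

Section MonomialMultiple.

Variables (k : comNzRingType) (S : nmodType).
Implicit Types f g : monoid_algebra k S.

Lemma mul_monoE f m0 :
  f * mono 1 m0 = \sum_(m <- msupp f) mono (mcoeff m f) (m + m0).
Proof.
rewrite [in LHS](ma_sumE f) [LHS]ma_mul_suml; apply/eq_bigr=> m _.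
by rewrite ma_mul_mono mulr1.
Qed.

(** By cancellation no two terms of [f] collide after the shift by [m1], so the coefficient at
    [m + m1] is that of [f] at [m], which is nonzero; on the right it can only come from a term of
    [g] shifted by [m2]. *)
Lemma mul_mono_supp f g m1 m2 m : injective (+%R m1) ->
  f * mono 1 m1 = g * mono 1 m2 -> m \in msupp f ->
  exists m', m + m1 = m' + m2.
Proof.
move=> inj /(congr1 (mcoeff (m + m1))).
rewrite !mul_monoE !raddf_sum /= => e mf.
apply: contrapT => nex; move: mf; rewrite -mcoeff_neq0 => /negP; apply.
apply/eqP; move: e; rewrite [RHS]big1; last first.
  move=> m' _; rewrite mcoeffU; case: eqP => // e.
  by case: nex; exists m'.
move=> <-; have [mf|mf] := boolP (m \in msupp f); last first.
  rewrite mcoeff_outdom // big_seq big1 // => m' m'f.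
  rewrite mcoeffU; case: eqP => //; rewrite !(addrC _ m1) => /inj e.
  by rewrite e (negPf mf) in m'f.
rewrite (big_fsetD1 m) //= mcoeffUU big_seq big1 ?addr0 // => m'.
rewrite in_fsetD1 => /andP[/eqP nm _].
by rewrite mcoeffU; case: eqP => //; rewrite !(addrC _ m1) => /inj.
Qed.

End MonomialMultiple.

(** * Roots and dominant chambers of D_n *)

Section Roots.

Variable R : realType.

(** For i < j these are the positive roots of the dominant chamber; [e = true] gives the minus
    sign. *)
Definition rootD n (i j : 'I_n) (e : bool) : 'rV[int]_n :=
  delta_mx 0 i + (-1) ^+ e *: delta_mx 0 j.

Lemma rootDP n (i j : 'I_n) e : (i < j)%N -> rootsD (rootD i j e).
Proof.
by move=> ij; exists i, j; split=> //; exists false, e; rewrite scale1r.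
Qed.

Lemma pairing_delta n (i : 'I_n) (v : 'rV[R]_n) :
  pairing (delta_mx 0 i) v = v 0 i.
Proof.
rewrite /pairing (bigD1 i) //= mxE !eqxx mul1r big1 ?addr0 // => j ne.
by rewrite mxE eqxx (negPf ne) mul0r.
Qed.

Lemma pairingZl n (a : int) m (v : 'rV[R]_n) :
  pairing (a *: m) v = a%:~R * pairing m v.
Proof.
by rewrite /pairing mulr_sumr; apply: eq_bigr => i _; rewrite mxE intrM mulrA.
Qed.

Lemma pairingBr n (m : 'rV[int]_n) (v w : 'rV[R]_n) :
  pairing m (v - w) = pairing m v - pairing m w.
Proof.
by rewrite /pairing -sumrB; apply: eq_bigr => i _; rewrite !mxE mulrBr.
Qed.

Lemma pairing_rootsD n (i j : 'I_n) (e e' : bool) (v : 'rV[R]_n) :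
  pairing ((-1) ^+ e *: delta_mx 0 i + (-1) ^+ e' *: delta_mx 0 j) v
  = (-1) ^+ e * v 0 i + (-1) ^+ e' * v 0 j.
Proof. by rewrite pairingDl !pairingZl !pairing_delta !rmorphXn. Qed.

Lemma pairing_rootD n (i j : 'I_n) (e : bool) (v : 'rV[R]_n) :
  pairing (rootD i j e) v = v 0 i + (-1) ^+ e * v 0 j.
Proof. by rewrite pairingDl !pairingZl !pairing_delta !rmorphXn. Qed.

(** The absolute value merges the inequalities of the two roots u_i - u_j and u_i + u_j. *)
Definition dominant n (v : 'rV[R]_n) :=
  forall i j : 'I_n, (i < j)%N -> `|v 0 j| <= v 0 i.
Definition strictly_dominant n (v : 'rV[R]_n) :=
  forall i j : 'I_n, (i < j)%N -> `|v 0 j| < v 0 i.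

Lemma dominant_chamber n (v0 v : 'rV[R]_n) :
  strictly_dominant v0 -> dominant v -> closed_chamber (@rootsD n) v0 v.
Proof.
move=> d0 d a [i [j [ij [e [e' ->]]]]]; rewrite !pairing_rootsD.
move: (d0 i j ij) (d i j ij); rewrite ltr_norml ler_norml.
by move=> /andP[? ?] /andP[? ?]; case: e; case: e'; rewrite ?expr0 ?expr1; lra.
Qed.

Lemma strictly_dominant_regular n (v : 'rV[R]_n) :
  strictly_dominant v -> regular_vector (@rootsD n) v.
Proof.
move=> d a [i [j [ij [e [e' ->]]]]]; rewrite pairing_rootsD.
move: (d i j ij); rewrite ltr_norml => /andP[? ?]; apply/eqP.
by case: e; case: e'; rewrite ?expr0 ?expr1; lra.
Qed.

Lemma chamber_in_fan n (Phi : set 'rV[int]_n) (v0 : 'rV[R]_n) :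
  regular_vector Phi v0 -> weyl_fan Phi (closed_chamber Phi v0).
Proof.
have z (v : 'rV[R]_n) : \sum_i (0 : 'rV[R]_n) 0 i * v 0 i = 0.
  by rewrite big1 // => i _; rewrite mxE mul0r.
(* The functional 0 cuts out the chamber as a face of itself. *)
move=> reg; exists v0 => //; exists 0; split=> [v _|]; first by rewrite z.
by apply/seteqP; split=> v /=; [split|case].
Qed.

Lemma root_dual_pred n (Phi : set 'rV[int]_n) (v0 : 'rV[R]_n) a :
  Phi a -> 0 < pairing a v0 ->
  a \in dual_monoid_pred Phi (closed_chamber Phi v0).
Proof.
move=> Pa pos; apply/asboolP; split; last by move=> v; apply.
exists [:: (1, a)]; last by rewrite big_seq1.
by move=> x; rewrite inE => /eqP ->.
Qed.

Lemma rootD_dual_pred n (v0 : 'rV[R]_n) (i j : 'I_n) e :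
  strictly_dominant v0 -> (i < j)%N ->
  rootD i j e \in dual_monoid_pred (@rootsD n) (closed_chamber (@rootsD n) v0).
Proof.
move=> d ij; apply: root_dual_pred; first exact: rootDP.
move: (d i j ij); rewrite pairing_rootD ltr_norml => /andP[? ?].
by case: e; rewrite ?expr0 ?expr1; lra.
Qed.

End Roots.

(** * Distinguished points of affine charts *)

Section Vanishing.

Variables (k : fieldType) (R : realType) (n : nat) (Phi : set 'rV[int]_n).
Variables (sigma : set 'rV[R]_n) (v : 'rV[R]_n).
Hypothesis sv : sigma v.

(* The point of U_sigma with these coordinates is the distinguished point of
   the orbit of the face having v in its relative interior. *)
Definition vanishing_char (m : dual_monoid Phi sigma) : k :=
  (pairing (dual_val m) v == 0)%:R.

Lemma dual_pos (m : dual_monoid Phi sigma) (w : 'rV[R]_n) :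
  sigma w -> 0 <= pairing (dual_val m) w.
Proof. by move=> sw; have /asboolP[_] := dual_valP m; apply. Qed.

Lemma vanishing_char0 : vanishing_char 0 = 1.
Proof. by rewrite /vanishing_char pairing0l eqxx. Qed.

(** A sum of two nonnegative numbers vanishes only if both do. *)
Lemma vanishing_charD :
  {morph vanishing_char : m1 m2 / m1 + m2 >-> m1 * m2}.
Proof.
move=> m1 m2; rewrite /vanishing_char pairingDl.
by rewrite paddr_eq0 ?dual_pos // -natrM mulnb.
Qed.

End Vanishing.

(** * The dominant charts of D_{n+2} and D_{n+3} *)

Section DominantCharts.

Variables (k : fieldType) (R : realType) (n : nat).

(* Twice the strictly dominant vector (n+2, ..., 1, 0): the factor 2 keeps
   vb - r in sigma. *)
Let v0 : 'rV[R]_(n.+2 + 1) := \row_i (2 * (n.+2 - i))%:R.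

Lemma v0_dominant : strictly_dominant v0.
Proof.
move=> i j ij; rewrite !mxE ger0_norm // ltr_nat.
by have := ltn_ord j; lia.
Qed.

Let vb : 'rV[R]_n.+2 := lsubmx v0.

Lemma vb_dominant : strictly_dominant vb.
Proof.
move=> i j ij; have := @v0_dominant (lshift 1 i) (lshift 1 j) ij.
by rewrite !mxE.
Qed.

Let sigma' := closed_chamber (@rootsD (n.+2 + 1)) v0.
Let sigma := closed_chamber (@rootsD n.+2) vb.

Lemma sigma_maps : maps_into (inclusionD R n.+2) sigma' sigma.
Proof.
move=> v sv a Pa; rewrite -!inclD_adj; apply: sv; exact: inclD_root.
Qed.

(* A generator of the ray of sigma on which u_{n+1} + u_{n+2} vanishes and
   u_{n+1} - u_{n+2} does not. *)
Let r : 'rV[R]_n.+2 := \row_i (if i == ord_max then -1 else 1).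

Lemma r_sigma : sigma r.
Proof.
apply: dominant_chamber; first exact: vb_dominant.
move=> i j ij; rewrite !mxE; have -> : (i == ord_max) = false.
  by apply/eqP => e; rewrite e /= in ij; have := ltn_ord j; lia.
by case: ifP; rewrite ?normrN normr1.
Qed.

(** Splits [vb] into two vectors of [sigma], so that a character nonnegative on [sigma] and zero at
    [vb] is zero at [r]. *)
Lemma vb_sub_r_sigma : sigma (vb - r).
Proof.
apply: dominant_chamber; first exact: vb_dominant.
move=> i j ij; rewrite !mxE /=; have -> : (i == ord_max) = false.
  by apply/eqP => e; rewrite e /= in ij; have := ltn_ord j; lia.
have vj : 2 <= (2 * (n.+2 - j))%:R :> R.
  by rewrite ler_nat; have := ltn_ord j; lia.
(* The gap 2 is just enough: the last two entries of [vb - r] are both 3. *)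
have vi : (2 * (n.+2 - j))%:R + 2 <= (2 * (n.+2 - i))%:R :> R.
  by rewrite -natrD ler_nat; have := ltn_ord j; lia.
by rewrite ger0_norm; case: ifP => _; lra.
Qed.

Let i0 : 'I_n.+2 := inord n.

Lemma i0_lt : (i0 < @ord_max n.+1)%N.
Proof. by rewrite /i0 /= inordK. Qed.

(** The exponents u_{n+1} - u_{n+2} of x ([e = true]) and u_{n+1} + u_{n+2} of y ([e = false]). *)
Let end_root e : dual_monoid (@rootsD n.+2) sigma :=
  DualMonoid (rootD_dual_pred e vb_dominant i0_lt).

Lemma i1_lt : (lshift 1 (@ord_max n.+1) < rshift n.+2 (@ord0 0))%N.
Proof. by rewrite /= addn0. Qed.

(** The roots u_{n+2} - u_{n+3} and u_{n+2} + u_{n+3}, whose sum 2 u_{n+2} is the exponent of w. *)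
Let end_root' e : dual_monoid (@rootsD (n.+2 + 1)) sigma' :=
  DualMonoid (rootD_dual_pred e v0_dominant i1_lt).

Lemma dual_map_end_root :
  dual_map sigma_maps (end_root true) + (end_root' true + end_root' false) =
  dual_map sigma_maps (end_root false).
Proof.
apply: val_inj; rewrite /= /rootD !delta_mx_lshift /inclD.
apply/rowP => i; rewrite !mxE; case: split => j; rewrite !mxE; ring.
Qed.

Let v0_sigma : sigma' v0.
Proof. by move=> a _ /ltW. Qed.

(** Since [v0] is interior to [sigma'], the character is 1 at 0 and 0 elsewhere: this is evaluation
    at the torus-fixed point of the chart. *)
Let ev := ma_evalM (vanishing_char0 k (@rootsD (n.+2+1)) sigma' v0)
  (vanishing_charD k v0_sigma).

(** Each exponent of [u] plus that of y is a multiple of x, which makes it positive on [r], hence on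
    [vb]; such monomials vanish at the fixed point. *)
Lemma dominant_no_division u a :
  u * mono 1 (end_root false) = mono 1 (end_root true) * a ->
  ev (chart_map k sigma_maps u) = 0.
Proof.
move=> e; apply: ma_eval_map_eq0 => m mu.
rewrite /vanishing_char; case: eqP => [/= m0|//].
have [|m' mm'] := mul_mono_supp _ (etrans e (mulrC _ _)) mu.
  by move=> m1 m2 /(congr1 val) /= /addrI /val_inj.
exfalso; rewrite inclD_adj -/vb in m0.
have h1 := dual_pos m r_sigma.
have h2 := dual_pos m vb_sub_r_sigma.
have h3 := dual_pos m' r_sigma.
rewrite pairingBr m0 in h2.
(* At [r] the exponent of y is 0 and that of x is 2, so [m] takes there a value at least 2, while
   [h2] bounds it by 0. *)
have := congr1 (fun m => pairing (dual_val m) r) mm'.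
rewrite /= /rootD !(pairingDl, pairingZl, pairing_delta) !rmorphXn /=.
rewrite !mxE eqxx.
have -> : (i0 == ord_max) = false.
  by apply/eqP => e'; have := i0_lt; rewrite e' ltnn.
rewrite expr0 expr1; lra.
Qed.

Lemma inclusionD_not_flat : ~ toric_morphism_flat k (inclusionD R n.+2).
Proof.
move=> flat.
have F' := chamber_in_fan (strictly_dominant_regular v0_dominant).
have F := chamber_in_fan (strictly_dominant_regular vb_dominant).
have := flat (ToricPoint F' (ker_point ev)) sigma F sigma_maps.
apply: (@stalk_map_not_flat _ _ _ _ _ (mono 1 (end_root true))
  (mono 1 (end_root false)) (mono 1 (end_root' true + end_root' false))).
  2: exact: dominant_no_division.
exact: ma_map_mono1M dual_map_end_root.
Qed.

End DominantCharts.

Theorem mainTheorem16 (k : fieldType) (R : realType) (n : nat) (hn : (2 <= n)%N) :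
  ~ toric_morphism_flat k (inclusionD R n).
Proof.
by case: n hn => [|[|n]] // _; exact: inclusionD_not_flat.
Qed.
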